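(* Let $\Omega\subset\mathbb{R}^n$ be a bounded domain. If $\Omega$ is quasihyperbolically well behaved, then $\Omega$ has no geodesic loop in $\overline{\Omega}^{Euc}$.
   Context: For a domain $\Omega\subsetneq\mathbb{R}^n$, $\partial_{Euc}\Omega$ and $\overline{\Omega}^{Euc}$ are its Euclidean boundary and closure, and $\delta_\Omega(x)=d_{Euc}(x,\partial_{Euc}\Omega)$. The quasihyperbolic metric is $k_\Omega(x,y)=\inf_\gamma\int_\gamma\frac{|dx|}{\delta_\Omega(x)}$, the infimum over rectifiable curves in $\Omega$ joining $x$ and $y$; $(\Omega,k_\Omega)$ is a complete, proper, geodesic metric space. A quasihyperbolic geodesic (geodesic line) is a geodesic (line) of $(\Omega,k_\Omega)$. For a curve $\gamma$, $k_\Omega(x_0,\gamma)$ denotes the $k_\Omega$-distance from $x_0$ to the image of $\gamma$. A bounded domain $\Omega\subset\mathbb{R}^n$ is quasihyperbolically well behaved if, whenever $\{x_k\},\{y_k\}$ are sequences in $\Omega$ with $\lim_{k}x_k=\lim_k y_k=p\in\partial_{Euc}\Omega$ and $\gamma_k:[a_k,b_k]\to\Omega$ is a sequence of quasihyperbolic geodesics joining $x_k$ and $y_k$, one has $\lim_{k\to\infty}k_\Omega(x_0,\gamma_k)=\infty$ for some (hence all) $x_0\in\Omega$. For a quasihyperbolic geodesic line $\gamma:(-\infty,\infty)\to\Omega$, let $\Gamma^{\infty}_\gamma$ (resp. $\Gamma^{-\infty}_\gamma$) be the set of $x\in\overline{\Omega}^{Euc}$ for which there is a sequence $t_k\to\infty$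 (resp. $t_k\to-\infty$) with $\gamma(t_k)\to x$. The line $\gamma$ is a geodesic loop in $\overline{\Omega}^{Euc}$ if $\Gamma^{\infty}_\gamma=\Gamma^{-\infty}_\gamma$; $\Omega$ has no geodesic loop in $\overline{\Omega}^{Euc}$ if no quasihyperbolic geodesic line in $\Omega$ is such a loop. *)

(* Defs.v *)
From HB Require Import structures.
From mathcomp Require Import all_boot all_order all_algebra.
From mathcomp Require Import all_classical all_reals all_analysis.
Import Order.TTheory GRing.Theory Num.Theory numFieldNormedType.Exports.

Set Implicit Arguments.
Unset Strict Implicit.
Unset Printing Implicit Defensive.

Local Open Scope classical_set_scope.
Local Open Scope ring_scope.

(* R^n is 'rV[R]_n. The norm `|v| of the library on 'rV[R]_n is the sup norm:
   it is only used for the topology and for boundedness, which are those of the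
   Euclidean norm; lengths and distances are measured with enorm. *)
Definition enorm (R : realType) (n : nat) (v : 'rV[R]_n) : R :=
  Num.sqrt (\sum_(i < n) v 0 i ^+ 2).

Definition domain (R : realType) (n : nat) (Omega : set 'rV[R]_n) : Prop :=
  [/\ Omega !=set0, open Omega & connected Omega].

Definition boundary (T : topologicalType) (A : set T) : set T :=
  closure A `\` interior A.

Definition bdist (R : realType) (n : nat) (Omega : set 'rV[R]_n)
    (x : 'rV[R]_n) : R :=
  inf [set enorm (x - y) | y in boundary Omega].

(* A curve [a, b] -> R^n is given by a total function R -> 'rV[R]_n of which only
   the restriction to `[a, b] matters. The list s stands for the partition
   a < s_1 < ... < s_m = b (s is empty when a = b). *)
Definition polygonal_length (R : realType) (n : nat) (gamma : R -> 'rV[R]_n)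
    (a : R) (s : seq R) : R :=
  \sum_(i < size s) enorm (gamma (nth a s i) - gamma (nth a (a :: s) i)).

Definition curve_length (R : realType) (n : nat) (gamma : R -> 'rV[R]_n)
    (a b : R) : \bar R :=
  ereal_sup [set (polygonal_length gamma a s)%:E | s in itv_partition a b].

Definition rectifiable_curve (R : realType) (n : nat) (gamma : R -> 'rV[R]_n)
    (a b : R) : Prop :=
  [/\ a <= b, {within `[a, b], continuous gamma}
    & (curve_length gamma a b < +oo)%E].

(* For a rectifiable curve and 0 <= s <= its length, the set below has exactly
   one element; gamma a is a default value outside of this range. *)
Definition arclength_param (R : realType) (n : nat) (gamma : R -> 'rV[R]_n)
    (a b s : R) : 'rV[R]_n :=
  xget (gamma a)
    [set gamma t | t in [set t | t \in `[a, b] /\ curve_length gamma a t = s%:E]].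

Definition line_integral (R : realType) (n : nat) (rho : 'rV[R]_n -> R)
    (gamma : R -> 'rV[R]_n) (a b : R) : \bar R :=
  (\int[lebesgue_measure]_(s in `[0%R, fine (curve_length gamma a b)])
     (rho (arclength_param gamma a b s))%:E)%E.

Definition qh_dist (R : realType) (n : nat) (Omega : set 'rV[R]_n)
    (x y : 'rV[R]_n) : \bar R :=
  ereal_inf [set I | exists (a b : R) (gamma : R -> 'rV[R]_n),
    [/\ rectifiable_curve gamma a b,
        (forall t, t \in `[a, b] -> Omega (gamma t)),
        gamma a = x, gamma b = y
      & I = line_integral (fun z => (bdist Omega z)^-1) gamma a b]].

Definition qh_geodesic (R : realType) (n : nat) (Omega : set 'rV[R]_n)
    (gamma : R -> 'rV[R]_n) (a b : R) : Prop :=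
  [/\ a <= b,
      (forall t, t \in `[a, b] -> Omega (gamma t))
    & forall s t, s \in `[a, b] -> t \in `[a, b] ->
        qh_dist Omega (gamma s) (gamma t) = `|s - t|%:E].

Definition qh_geodesic_line (R : realType) (n : nat) (Omega : set 'rV[R]_n)
    (gamma : R -> 'rV[R]_n) : Prop :=
  (forall t, Omega (gamma t)) /\
  (forall s t, qh_dist Omega (gamma s) (gamma t) = `|s - t|%:E).

Definition qh_dist_curve (R : realType) (n : nat) (Omega : set 'rV[R]_n)
    (x0 : 'rV[R]_n) (gamma : R -> 'rV[R]_n) (a b : R) : \bar R :=
  ereal_inf [set qh_dist Omega x0 (gamma t) | t in `[a, b]].

Definition qh_well_behaved (R : realType) (n : nat) (Omega : set 'rV[R]_n) :
    Prop :=
  forall (x y : nat -> 'rV[R]_n) (p : 'rV[R]_n) (a b : nat -> R)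
    (gamma : nat -> R -> 'rV[R]_n),
    (forall k, Omega (x k)) -> (forall k, Omega (y k)) ->
    boundary Omega p ->
    x k @[k --> \oo] --> p -> y k @[k --> \oo] --> p ->
    (forall k, [/\ qh_geodesic Omega (gamma k) (a k) (b k),
                   gamma k (a k) = x k & gamma k (b k) = y k]) ->
    exists2 x0 : 'rV[R]_n, Omega x0 &
      (qh_dist_curve Omega x0 (gamma k) (a k) (b k) @[k --> \oo] --> +oo)%E.

Definition limit_set_pinfty (R : realType) (n : nat) (Omega : set 'rV[R]_n)
    (gamma : R -> 'rV[R]_n) : set 'rV[R]_n :=
  [set x | closure Omega x /\ exists t : nat -> R,
    t k @[k --> \oo] --> +oo /\ gamma (t k) @[k --> \oo] --> x].

Definition limit_set_ninfty (R : realType) (n : nat) (Omega : set 'rV[R]_n)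
    (gamma : R -> 'rV[R]_n) : set 'rV[R]_n :=
  [set x | closure Omega x /\ exists t : nat -> R,
    t k @[k --> \oo] --> -oo /\ gamma (t k) @[k --> \oo] --> x].

Definition geodesic_loop (R : realType) (n : nat) (Omega : set 'rV[R]_n)
    (gamma : R -> 'rV[R]_n) : Prop :=
  qh_geodesic_line Omega gamma /\
  limit_set_pinfty Omega gamma = limit_set_ninfty Omega gamma.

Definition has_no_geodesic_loop (R : realType) (n : nat)
    (Omega : set 'rV[R]_n) : Prop :=
  forall gamma : R -> 'rV[R]_n, ~ geodesic_loop Omega gamma.

(* Main.v *)
Require Import Defs.
From mathcomp Require Import all_boot all_order all_algebra.
From mathcomp Require Import all_classical all_reals all_analysis.
From mathcomp Require Import ring lra.
Import Order.TTheory GRing.Theory Num.Theory numFieldNormedType.Exports.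

(** Suppose that a quasihyperbolic geodesic line [gamma] were a loop.

    Since [Omega] is bounded, [gamma (t)] accumulates at some point [p] as
    [t --> +oo] ([limit_set_pinfty_nonempty]). The point [p] lies on the boundary
    ([geodesic_line_limit_boundary]): around an interior point the quasihyperbolic
    distance is bounded ([qh_dist_near]), whereas two points [gamma t], [gamma t']
    of the line are at distance [|t - t'|], which is unbounded along a sequence
    of parameters going to infinity. Because [gamma] is a loop, [p] is also a limit
    point at [-oo], so there are [s_k --> -oo] and [t_k --> +oo] along which
    [gamma] tends to [p]. The restrictions of [gamma] to [[s_k, t_k]] are geodesics
    whose endpoints converge to the same boundary point, so good behaviour forces
    their distance to some [x0] to go to infinity. But for large [k] they all pass
    through [gamma 0], which is at finite distance from [x0]
    ([qh_dist_domain_bounded]).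

    Everything needed about the metric is an upper bound for it, and such bounds
    all come from [qh_dist_lipschitz]: if a [K]-Lipschitz curve stays at
    distance [r] from the complement of [Omega], then its length is finite and the
    density is at most [1 / r] on it. For [qh_dist_near] the curve is a segment;
    for [qh_dist_domain_bounded] it is obtained by chaining segments, which reach
    every point of [Omega] because [Omega] is open and connected
    ([domain_reachable]). *)

Set Implicit Arguments.
Unset Strict Implicit.
Unset Printing Implicit Defensive.

Local Open Scope classical_set_scope.
Local Open Scope ring_scope.

(** * Comparison of the Euclidean norm and the sup norm *)

Lemma norm_le_enorm (R : realType) (n : nat) (v : 'rV[R]_n) : `|v| <= enorm v.
Proof.
rewrite [`|v|]mx_normrE; apply: bigmax_le => [|[i j] _ /=]; first exact: sqrtr_ge0.
rewrite ord1 -sqrtr_sqr ler_wsqrtr// (bigD1 j)//= lerDl.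
by apply: sumr_ge0 => k _; exact: sqr_ge0.
Qed.

Lemma coord_le_norm (R : realType) (n : nat) (v : 'rV[R]_n) i :
  `|v 0 i| <= `|v|.
Proof. by rewrite [leRHS]mx_normrE; apply: (le_bigmax _ _ (0, i)). Qed.

Lemma enorm_le_norm (R : realType) (n : nat) (v : 'rV[R]_n) :
  enorm v <= n%:R * `|v|.
Proof.
have nv0 : 0 <= n%:R * `|v| by rewrite mulr_ge0.
rewrite -(ger0_norm nv0) -sqrtr_sqr ler_wsqrtr//.
apply: (@le_trans _ _ (\sum_(i < n) `|v| ^+ 2)).
  apply: ler_sum => i _; rewrite -[leLHS]real_normK ?num_real//.
  by rewrite lerXn2r ?nnegrE// coord_le_norm.
rewrite sumr_const card_ord -[leLHS]mulr_natl exprMn ler_wpM2r ?sqr_ge0//.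
by rewrite -natrX ler_nat; case: (n) => // m; rewrite expnS leq_pmulr.
Qed.

(** * Quasihyperbolic length of Lipschitz curves *)

(** The integral of a nonnegative function is a supremum over simple functions
    below it, so it is monotone even for non-measurable functions. It is applied
    to the density along a curve parametrized by arc length. *)
Lemma nonneg_integral_le_cst d (T : measurableType d) (R : realType)
    (mu : {measure set T -> \bar R}) (D : set T) (f : T -> \bar R) (c : R) :
  measurable D -> (forall x, D x -> 0 <= f x)%E -> (forall x, D x -> f x <= c%:E)%E ->
  (\int[mu]_(x in D) f x <= c%:E * mu D)%E.
Proof.
move=> mD f0 fc; rewrite -integral_cst//.
have c0 x : D x -> (0 <= cst c%:E x)%E by move=> Dx; exact: le_trans (f0 _ Dx) (fc _ Dx).
rewrite !ge0_integralE//; apply: le_ereal_sup => _ [h /= hf <-].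
exists h => // x; apply: le_trans (hf x) _; apply: lee_restrict => //.
Qed.

(** The estimate is required on the whole line, not only on the parameter
    interval, so that curves can be modified by adding clamped segments. *)
Definition lipschitz_curve (R : realType) (n : nat) (K : R)
    (gamma : R -> 'rV[R]_n) : Prop :=
  forall s t, `|gamma s - gamma t| <= K * `|s - t|.

Lemma lipschitz_curve_continuous (R : realType) (n : nat) (K : R)
    (gamma : R -> 'rV[R]_n) : lipschitz_curve K gamma -> continuous gamma.
Proof.
move=> lip t; apply/cvgrPdist_lt => e e0.
have K1 : 0 < `|K| + 1 by rewrite ltr_wpDl.
near=> s.
have st : `|t - s| < e / (`|K| + 1).
  by near: s; apply: cvgr_dist_lt => //; rewrite divr_gt0.
apply: le_lt_trans (lip _ _) _; move: st; rewrite ltr_pdivlMr// => st.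
apply: le_lt_trans st; rewrite mulrC ler_wpM2l//.
by rewrite (le_trans (ler_norm _))// lerDl.
Unshelve. all: by end_near. Qed.

(** The bounds [K * (t_{i+1} - t_i)] on the sides add up to [K * (b - a)]; the
    factor [n] is the cost of passing from the sup norm to the Euclidean one. *)
Lemma polygonal_length_lipschitz (R : realType) (n : nat) (K a b : R)
    (gamma : R -> 'rV[R]_n) (s : seq R) :
  lipschitz_curve K gamma -> itv_partition a b s ->
  polygonal_length gamma a s <= n%:R * K * (b - a).
Proof.
move=> lip ps; rewrite /polygonal_length.
have telescope : \sum_(i < size s)
    (nth a (a :: s) i.+1 - nth a (a :: s) i) = b - a.
  rewrite -(big_mkord xpredT (fun i => nth a (a :: s) i.+1 - nth a (a :: s) i)).
  by rewrite telescope_sumr// (itv_partition_nth_size a ps).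
rewrite -telescope mulr_sumr; apply: ler_sum => i _.
apply: le_trans (enorm_le_norm _) _.
rewrite -mulrA ler_wpM2l//; apply: le_trans (lip _ _) _.
rewrite ger0_norm// subr_ge0 ltW//.
by case: ps => /(pathP a) + _; apply.
Qed.

Lemma curve_length_lipschitz (R : realType) (n : nat) (K a b : R)
    (gamma : R -> 'rV[R]_n) :
  lipschitz_curve K gamma ->
  (curve_length gamma a b <= (n%:R * K * (b - a))%:E)%E.
Proof.
move=> lip; apply: ge_ereal_sup => _ [s ps <-].
by rewrite lee_fin polygonal_length_lipschitz.
Qed.

(** This is the sup-norm ball of radius [r] around [z] being contained in
    [Omega]; it replaces lower bounds on the distance to the boundary. *)
Definition clearance (R : realType) (n : nat) (Omega : set 'rV[R]_n) (r : R)
    (z : 'rV[R]_n) : Prop :=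
  forall w, `|z - w| < r -> Omega w.

(** The bound also holds when the boundary is empty: the infimum of the empty
    set is [0] and the inverse of [0] is [0]. *)
Lemma clearance_bdistV (R : realType) (n : nat) (Omega : set 'rV[R]_n) (r : R)
    (z : 'rV[R]_n) :
  open Omega -> 0 < r -> clearance Omega r z -> 0 <= (bdist Omega z)^-1 <= r^-1.
Proof.
move=> oO r0 cz; rewrite /bdist; set E := (X in inf X).
have [->|] := eqVneq E set0; first by rewrite inf0 invr0 lexx invr_ge0 ltW.
move=> /set0P E0; suff rE : r <= inf E.
  by rewrite invr_ge0 (le_trans (ltW r0) rE)/= lef_pV2// posrE (lt_le_trans r0).
apply: lb_le_inf => // _ [y [_ yO] <-].
rewrite leNgt; apply/negP => zy; apply: yO.
rewrite (interior_id _).1//; apply: cz.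
by apply: le_lt_trans zy; exact: norm_le_enorm.
Qed.

(** The infimum defining the distance is at most the integral along [gamma], that
    is, at most the length of [gamma] times a bound for the density on the image of
    [gamma], where the arc-length parametrization takes its values. *)
Lemma qh_dist_lipschitz (R : realType) (n : nat) (Omega : set 'rV[R]_n)
    (K r a b : R) (gamma : R -> 'rV[R]_n) :
  open Omega -> 0 < r -> a <= b -> 0 <= K -> lipschitz_curve K gamma ->
  (forall t, t \in `[a, b] -> clearance Omega r (gamma t)) ->
  (qh_dist Omega (gamma a) (gamma b) <= (r^-1 * (n%:R * K * (b - a)))%:E)%E.
Proof.
move=> oO r0 ab K0 lip clr.
have Ogamma t : t \in `[a, b] -> Omega (gamma t).
  by move=> tab; apply: (clr t tab); rewrite subrr normr0.
have len := curve_length_lipschitz a b lip.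
have rect : rectifiable_curve gamma a b.
  split => //; last exact: le_lt_trans len (ltry _).
  apply: continuous_subspaceT; exact: lipschitz_curve_continuous lip.
apply: (@le_trans _ _ (line_integral (fun z => (bdist Omega z)^-1) gamma a b)).
  by apply: ereal_inf_lbound; exists a, b, gamma.
rewrite /line_integral; set L := fine _.
have clr_arc s : clearance Omega r (arclength_param gamma a b s).
  rewrite /arclength_param; case: xgetP => [z _ [t [tab _] <-]|_]; first exact: clr.
  by apply: clr; rewrite in_itv/= lexx.
(* [fine] sends infinite values to [0]; the second case covers them. *)
have Lle : L <= n%:R * K * (b - a) \/ L = 0.
  rewrite /L; case: (curve_length gamma a b) len => [l| |] /=; last 2 first.
  - by right.
  - by right.
  by rewrite lee_fin; left.
have bnd0 : 0 <= n%:R * K * (b - a) by rewrite !mulr_ge0// subr_ge0.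
have {Lle} Lle : L <= n%:R * K * (b - a) by case: Lle => // ->.
have mI : (lebesgue_measure [set` `[0%R, L]] <= (n%:R * K * (b - a))%:E)%E.
  rewrite lebesgue_measure_itv/=; case: ifP => _; last by rewrite lee_fin.
  by rewrite sube0 lee_fin.
apply: le_trans (nonneg_integral_le_cst (c := r^-1) _ _ _ _) _ => //.
- by move=> s _; rewrite lee_fin; case/andP: (clearance_bdistV oO r0 (clr_arc s)).
- by move=> s _; rewrite lee_fin; case/andP: (clearance_bdistV oO r0 (clr_arc s)).
rewrite EFinM lee_wpmul2l ?lee_fin ?invr_ge0 ?(ltW r0)//.
Qed.

Definition segment (R : realType) (n : nat) (x y : 'rV[R]_n) (t : R) : 'rV[R]_n :=
  x + t *: (y - x).

(** Balls of the sup norm are convex. *)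
Lemma segment_ball (R : realType) (n : nat) (c x y : 'rV[R]_n) (r t : R) :
  `|c - x| < r -> `|c - y| < r -> 0 <= t <= 1 -> `|c - segment x y t| < r.
Proof.
move=> cx cy /andP[t0 t1].
have -> : c - segment x y t = (1 - t) *: (c - x) + t *: (c - y).
  apply/rowP => i; rewrite /segment !mxE; ring.
apply: le_lt_trans (ler_normD _ _) _; rewrite !normrZ !ger0_norm ?subr_ge0//.
set m := Num.max `|c - x| `|c - y|.
have mr : m < r by rewrite gt_max cx.
apply: le_lt_trans mr; have -> : m = (1 - t) * m + t * m by ring.
by rewrite lerD// ler_wpM2l ?subr_ge0// le_max lexx ?orbT.
Qed.

Lemma ball_clearance (R : realType) (n : nat) (Omega : set 'rV[R]_n)
    (c z : 'rV[R]_n) (r : R) :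
  clearance Omega (r + r) c -> `|c - z| < r -> clearance Omega r z.
Proof.
move=> clr cz w zw; apply: clr; apply: le_lt_trans (ler_distD z _ _) _.
exact: ltrD.
Qed.

(** The segment from [x] to [y] stays in the ball of radius [r] around [c], hence
    has clearance [r], and has sup-norm length at most [2 * r]: the radius cancels
    from the bound. *)
Lemma qh_dist_near (R : realType) (n : nat) (Omega : set 'rV[R]_n)
    (c x y : 'rV[R]_n) (r : R) :
  open Omega -> 0 < r -> clearance Omega (r + r) c ->
  `|c - x| < r -> `|c - y| < r ->
  (qh_dist Omega x y <= (n%:R * 2)%:E)%E.
Proof.
move=> oO r0 clr cx cy.
have xy : `|y - x| <= 2 * r.
  apply: le_trans (ler_distD c _ _) _; rewrite distrC.
  by rewrite mulr_natl mulr2n lerD ?ltW.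
have lip : lipschitz_curve (2 * r) (segment x y).
  move=> s t; rewrite /segment opprD addrACA subrr add0r -scalerBl normrZ mulrC.
  by rewrite ler_wpM2r.
have := @qh_dist_lipschitz _ _ Omega (2 * r) r 0 1 _ oO r0 ler01 _ lip.
rewrite /segment scale0r addr0 scale1r [x + _]addrC subrK.
rewrite subr0 mulr1 => H; apply: le_trans (H _ _) _.
- by rewrite mulr_ge0// ltW.
- move=> t; rewrite in_itv/= => t01; apply: (ball_clearance clr).
  exact: segment_ball.
rewrite lee_fin; suff -> : r^-1 * (n%:R * (2 * r)) = n%:R * 2 by [].
by field; rewrite gt_eqF.
Qed.

(** The radius has the form [r + r] because points of the ball of radius [r]
    around [z] then still have clearance [r]. *)
Lemma open_clearance (R : realType) (n : nat) (Omega : set 'rV[R]_n)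
    (z : 'rV[R]_n) :
  open Omega -> Omega z -> exists2 r, 0 < r & clearance Omega (r + r) z.
Proof.
rewrite openE => /[apply] /nbhs_ballP[e /= e0 eO].
exists (e / 2); first by rewrite divr_gt0.
by move=> w zw; apply: eO; rewrite -ball_normE/= [e]splitr.
Qed.

(** * Finiteness of the quasihyperbolic distance in a domain *)

Definition clamp01 (R : realType) (t : R) : R := Num.max 0 (Num.min t 1).

Lemma clamp01_itv (R : realType) (t : R) : 0 <= clamp01 t <= 1.
Proof. by rewrite /clamp01 le_max lexx/= ge_max ler01 ge_min lexx orbT. Qed.

Lemma clamp01_le0 (R : realType) (t : R) : t <= 0 -> clamp01 t = 0.
Proof. by move=> t0; apply/max_idPl; rewrite ge_min t0. Qed.

Lemma clamp01_ge1 (R : realType) (t : R) : 1 <= t -> clamp01 t = 1.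
Proof. by move=> t1; rewrite /clamp01 (min_idPr t1) (max_idPr ler01). Qed.

Lemma clamp01_lipschitz (R : realType) (s t : R) :
  `|clamp01 s - clamp01 t| <= `|s - t|.
Proof.
wlog st : s t / t <= s.
  move=> H; case: (leP t s) => [/H//|/ltW /H].
  by rewrite distrC (distrC t).
rewrite /clamp01 (ger0_norm (_ : 0 <= s - t)) ?subr_ge0//.
rewrite ler_norml /Num.max /Num.min.
by do ![case: ifP => /=]; rewrite ?ltNge => *; apply/andP; split; lra.
Qed.

(** Resting at [z] after the time [b] makes the concatenation with a segment
    from [z] a mere addition of curves; the clearance [r] is uniform because it has
    to bound the density along the whole curve. *)
Definition reachable (R : realType) (n : nat) (Omega : set 'rV[R]_n)
    (x z : 'rV[R]_n) : Prop :=
  exists (K r b : R) (gamma : R -> 'rV[R]_n),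
    [/\ [/\ 0 <= K, 0 < r & 0 <= b], lipschitz_curve K gamma, gamma 0 = x,
        (forall t, b <= t -> gamma t = z) &
        (forall t, clearance Omega r (gamma t))].

Lemma reachable_refl (R : realType) (n : nat) (Omega : set 'rV[R]_n)
    (x : 'rV[R]_n) : open Omega -> Omega x -> reachable Omega x x.
Proof.
move=> oO /(open_clearance oO)[r r0 clr].
exists 0, (r + r), 0, (fun=> x); split => //; first by split => //; rewrite addr_gt0.
by move=> s t; rewrite subrr normr0 mul0r.
Qed.

(** Append the segment from [z] to [w] by adding to the curve the vector [w - z]
    times a factor that grows from [0] to [1] between the times [b] and [b + 1]:
    before [b] only the old curve is seen, after [b] only the segment. *)
Lemma reachable_step (R : realType) (n : nat) (Omega : set 'rV[R]_n)
    (x z w c : 'rV[R]_n) (r : R) :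
  0 < r -> clearance Omega (r + r) c -> `|c - z| < r -> `|c - w| < r ->
  reachable Omega x z -> reachable Omega x w.
Proof.
move=> r0 clr cz cw [K [r' [b [gamma [[K0 r'0 b0] lip g0 gz clrg]]]]].
pose gamma' t := gamma t + clamp01 (t - b) *: (w - z).
have gamma'_before t : t <= b -> gamma' t = gamma t.
  by move=> tb; rewrite /gamma' clamp01_le0 ?subr_le0// scale0r addr0.
have gamma'_after t : b <= t -> gamma' t = segment z w (clamp01 (t - b)).
  by move=> bt; rewrite /gamma' gz.
exists (K + `|w - z|), (Num.min r r'), (b + 1), gamma'; split.
- by rewrite addr_ge0// lt_min r0 addr_ge0.
- move=> s t; rewrite /gamma' opprD addrACA -scalerBl mulrDl.
  apply: le_trans (ler_normD _ _) _; rewrite lerD// normrZ mulrC ler_wpM2l//.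
  apply: le_trans (clamp01_lipschitz _ _) _.
  by rewrite opprB addrA subrK.
- by rewrite gamma'_before.
- move=> t bt; rewrite gamma'_after; last by rewrite (le_trans _ bt)// lerDl.
  rewrite clamp01_ge1; last by rewrite lerBrDl.
  by rewrite /segment scale1r addrC subrK.
move=> t v; rewrite lt_min => /andP[vr vr'].
have [tb|/ltW bt] := leP t b.
  by apply: (clrg t); rewrite -gamma'_before.
apply: (ball_clearance clr) vr.
by rewrite gamma'_after//; apply: segment_ball => //; exact: clamp01_itv.
Qed.

(** The set of points reachable from [x] is open and closed in [Omega], because
    inside a ball contained in [Omega] one point is reachable as soon as another
    one is. *)
Lemma domain_reachable (R : realType) (n : nat) (Omega : set 'rV[R]_n)
    (x y : 'rV[R]_n) :
  domain Omega -> Omega x -> Omega y -> reachable Omega x y.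
Proof.
move=> [_ oO cO] Ox.
have reachO z : reachable Omega x z -> Omega z.
  move=> [K [r [b [gamma [[K0 r0 b0] lip g0 gz clrg]]]]].
  by apply: (clrg b); rewrite gz// subrr normr0.
suff -> : reachable Omega x = Omega by [].
apply: (cO (reachable Omega x)).
- by exists x; exact: reachable_refl.
- exists (reachable Omega x); last first.
    by apply/seteqP; split => [z xz|z []//]; split => //; exact: reachO.
  rewrite openE => z xz; have [r r0 clr] := open_clearance oO (reachO z xz).
  apply/nbhs_ballP; exists r => //= w; rewrite -ball_normE/= => zw.
  by apply: reachable_step xz; [exact: r0|exact: clr|rewrite subrr normr0|].
- exists (closure (reachable Omega x)); first exact: closed_closure.
  apply/seteqP; split => [z xz|z [Oz clz]].
    by split; [exact: reachO|exact: subset_closure].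
  have [r r0 clr] := open_clearance oO Oz.
  have [w [xw]] := clz _ (nbhsx_ballx z r r0).
  rewrite -ball_normE/= => zw.
  by apply: reachable_step xw; [exact: r0|exact: clr| |rewrite subrr normr0].
Qed.

Lemma qh_dist_domain_bounded (R : realType) (n : nat) (Omega : set 'rV[R]_n)
    (x y : 'rV[R]_n) :
  domain Omega -> Omega x -> Omega y -> exists M, (qh_dist Omega x y <= M%:E)%E.
Proof.
move=> dO Ox Oy; have [K [r [b [gamma [[K0 r0 b0] lip g0 gz clrg]]]]] :=
  domain_reachable dO Ox Oy.
have [_ oO _] := dO; rewrite -g0 -(gz b)//.
eexists; apply: (qh_dist_lipschitz oO r0 b0 K0 lip).
by move=> t _; exact: clrg.
Qed.

(** * Limit points of a quasihyperbolic geodesic line *)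

(** The closure of [Omega] is compact, so the filter of [gamma] at [+oo] has a
    cluster point there; a sequence of parameters realizing it is then chosen. *)
Lemma limit_set_pinfty_nonempty (R : realType) (n : nat)
    (Omega : set 'rV[R]_n) (gamma : R -> 'rV[R]_n) :
  bounded_set Omega -> (forall t, Omega (gamma t)) ->
  limit_set_pinfty Omega gamma !=set0.
Proof.
move=> bO Og.
have bcl : bounded_set (closure Omega).
  move: bO => [M [Mr MO]]; exists M; split => // N MN v clv.
  have : closed [set v : 'rV[R]_n | `|v| <= N].
    rewrite (_ : mkset _ = Num.norm @^-1` [set t | t <= N])//.
    by apply: closed_comp => // u _; exact: norm_continuous.
  by rewrite closure_id => ->; apply: closure_subset clv => u Ou; exact: MO.
have cpt := bounded_closed_compact bcl (@closed_closure _ _).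
have Fcl : (gamma @ +oo) (closure Omega).
  by exists 0; split => // t _; exact: subset_closure.
have [p [clp pF]] := cpt _ _ Fcl.
have near_p (k : nat) : exists t : R, k%:R < t /\ `|p - gamma t| < k.+1%:R^-1.
  have Fk : (gamma @ +oo) (gamma @` [set t | k%:R < t]).
    have : \forall t \near +oo, k%:R < t :> R by exact: nbhs_pinfty_gt.
    by apply: filterS => t kt; exists t.
  have [_ [[t kt <-]]] := pF _ _ Fk (nbhsx_ballx p k.+1%:R^-1 ltac:(by [])).
  by rewrite -ball_normE; exists t.
have [t tP] := choice near_p.
exists p; split => //; exists t; split.
  apply/cvgryPge => A; near=> k; apply: le_trans (ltW (tP k).1).
  by near: k; exact: nbhs_infty_ger.
apply/cvgrPdist_lt => e e0; near=> k; apply: lt_trans (tP k).2 _.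
by near: k; exact: near_infty_natSinv_lt (PosNum e0).
Unshelve. all: by end_near. Qed.

(** If the limit [p] of [gamma (t_k)] were inside [Omega], the distances from
    [gamma (t_k)] to a fixed late term [gamma (t_N)] would stay bounded by
    [qh_dist_near], although they are equal to [|t_k - t_N|]. *)
Lemma geodesic_line_limit_boundary (R : realType) (n : nat)
    (Omega : set 'rV[R]_n) (gamma : R -> 'rV[R]_n) (p : 'rV[R]_n) :
  open Omega -> qh_geodesic_line Omega gamma ->
  limit_set_pinfty Omega gamma p -> boundary Omega p.
Proof.
move=> oO [Og geo] [clp [t [ty tp]]]; split => // /interior_subset Op.
have [r r0 clr] := open_clearance oO Op.
have /cvgrPdist_lt/(_ r r0)[N _ Nr] := tp.
have /cvgryPgt/(_ (t N + n%:R * 2))[M _ MA] := ty.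
pose k := maxn N M.
have := qh_dist_near oO r0 clr (Nr k (leq_maxl _ _)) (Nr N (leqnn _)).
rewrite geo lee_fin leNgt => /negP; apply.
apply: lt_le_trans (ler_norm _); rewrite ltrBrDl.
exact: (MA k (leq_maxr _ _)).
Qed.

Theorem proposition2p2 (R : realType) (n : nat) (hn : (0 < n)%N)
  (Omega : set 'rV[R]_n) (hdom : domain Omega) (hbd : bounded_set Omega)
  (hwb : qh_well_behaved Omega) : has_no_geodesic_loop Omega.
Proof.
move=> gamma [line loop]; have [_ oO _] := hdom; have [Og geo] := line.
have [p pP] := limit_set_pinfty_nonempty hbd Og.
have bp := geodesic_line_limit_boundary oO line pP.
have [_ [t [ty tp]]] := pP.
have [_ [s [sNy sp]]] : limit_set_ninfty Omega gamma p by rewrite -loop.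
have [M _ Mt] := (cvgryPge _).1 ty 0.
have [N _ Ns] := (cvgrNyPle _).1 sNy 0.
(* From the index [m] on, the parameter [0] lies between [s_k] and [t_k]. *)
pose m := maxn M N.
have t0 k : 0 <= t (k + m)%N.
  by apply: Mt => /=; rewrite (leq_trans (leq_maxl M N))// leq_addl.
have s0 k : s (k + m)%N <= 0.
  by apply: Ns => /=; rewrite (leq_trans (leq_maxr M N))// leq_addl.
have sp' : gamma (s (k + m)%N) @[k --> \oo] --> p.
  exact: cvg_comp (cvg_addnr m) sp.
have tp' : gamma (t (k + m)%N) @[k --> \oo] --> p.
  exact: cvg_comp (cvg_addnr m) tp.
have [|x0 Ox0] := hwb _ _ p (fun k => s (k + m)%N) (fun k => t (k + m)%N)
    (fun=> gamma) (fun=> Og _) (fun=> Og _) bp sp' tp'.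
  by move=> k; split => //; split => //; exact: le_trans (s0 k) (t0 k).
have [l x0l] := qh_dist_domain_bounded hdom Ox0 (Og 0).
move=> /cvgeyPgt/(_ l)[K _ /(_ K (leqnn _))]/=; rewrite ltNge => /negP; apply.
apply: le_trans x0l; apply: ereal_inf_lbound; exists 0 => //.
by rewrite /= in_itv/= s0 t0.
Qed.
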